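(* Let $F\subset\mathbb{R}^d$ be bounded. Then $$\overline{\dim}_{GB} F=\overline{\dim}_B F.$$
   Context: For a nonempty bounded set $E\subset\mathbb{R}^d$ and $\delta>0$, $N_\delta(E)$ denotes the smallest number of closed balls of radius $\delta$ needed to cover $E$. $B(x,R)=\{y\in\mathbb{R}^d:\|y-x\|\le R\}$ is the closed Euclidean ball. The upper box dimension of a bounded set $F\subset\mathbb{R}^d$ is $\overline{\dim}_B F:=\limsup_{\delta\to 0}\frac{\log N_\delta(F)}{-\log\delta}$, with $\overline{\dim}_B\emptyset:=0$. For $\theta\in(0,1)$ and $F\subset\mathbb{R}^d$ (bounded or not), the Assouad spectrum is $\dim_A^\theta F:=\inf\{s\ge 0:$ there exists a constant $C>0$ such that for all $0<r=R^{1/\theta}<R<1$ and all $x\in F$, $N_r(B(x,R)\cap F)\le C(R/r)^s\}$, with $\dim_A^\theta\emptyset:=0$. The generalized upper box dimension of any $F\subset\mathbb{R}^d$ is $\overline{\dim}_{GB}F:=\limsup_{\theta\to 0}\dim_A^\theta F$ (with $\theta\to0$ through $(0,1)$). *)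

(* Defs.v *)
From mathcomp Require Import all_boot all_order all_algebra.
From mathcomp Require Import all_classical all_reals all_analysis.
Import Order.TTheory GRing.Theory Num.Theory.
Import numFieldNormedType.Exports.

Set Implicit Arguments.
Unset Strict Implicit.
Unset Printing Implicit Defensive.

Local Open Scope classical_set_scope.
Local Open Scope ring_scope.

(* R^d is 'rV[R]_d.  The norm `|x| that the library puts on matrices is the
   sup norm, hence the separate Euclidean norm. *)
Definition enorm (R : realType) (d : nat) (x : 'rV[R]_d) : R :=
  Num.sqrt (\sum_(i < d) x ord0 i ^+ 2).

Definition eball (R : realType) (d : nat) (x : 'rV[R]_d) (r : R) :
    set 'rV[R]_d :=
  [set y | enorm (y - x) <= r].

Definition covered_by (R : realType) (d : nat) (delta : R)
    (E : set 'rV[R]_d) (n : nat) : Prop :=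
  exists c : 'I_n -> 'rV[R]_d, E `<=` \bigcup_i eball (c i) delta.

(* N_delta(E).  The default value 0 is only taken when no finite cover exists,
   which cannot happen for E bounded and delta > 0. *)
Definition covering_number (R : realType) (d : nat) (delta : R)
    (E : set 'rV[R]_d) : nat :=
  xget 0%N [set n | covered_by delta E n /\
                    forall m, covered_by delta E m -> (n <= m)%N].

(* Meaningful for bounded F. *)
Definition upper_box_dim (R : realType) (d : nat) (F : set 'rV[R]_d) : \bar R :=
  if F == set0 then 0%E else
  limf_esup
    (fun delta : R => (ln (covering_number delta F)%:R / - ln delta)%:E)
    0^'+.

Definition assouad_spectrum (R : realType) (d : nat) (theta : R)
    (F : set 'rV[R]_d) : \bar R :=
  if F == set0 then 0%E else
  ereal_inf [set s%:E | s in [set s : R | 0 <= s /\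
    exists C : R, 0 < C /\
      forall r rho : R, 0 < r -> r = rho `^ theta^-1 -> r < rho -> rho < 1 ->
      forall x : 'rV[R]_d, F x ->
        (covering_number r (eball x rho `&` F))%:R <= C * (rho / r) `^ s]].

(* The limsup as theta -> 0 through (0,1): the filter 0^'+ only sees theta > 0
   arbitrarily small. *)
Definition generalized_upper_box_dim (R : realType) (d : nat)
    (F : set 'rV[R]_d) : \bar R :=
  limf_esup (fun theta : R => assouad_spectrum theta F) 0^'+.

(* Main.v *)
From Pilot Require Import Defs.
From mathcomp Require Import all_boot all_order all_algebra.
From mathcomp Require Import all_classical all_reals all_analysis.
From mathcomp Require Import ring lra.
Import Order.TTheory GRing.Theory Num.Theory.
Import numFieldNormedType.Exports.
(* Gives [covered_by] back its meaning for Euclidean balls, which the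
   homonym of the analysis library otherwise shadows. *)
Import Pilot.Defs.

Local Open Scope classical_set_scope.
Local Open Scope ring_scope.

(** Let [F] be nonempty and bounded, and write [r = rho ^ (1 / theta)], so that
[rho / r = r ^ -(1 - theta)]. Both inequalities compare the number of
[r]-balls needed for [F] with the number needed for a piece of [F] at scale
[rho].

Upper bound. If [N_r(F) <= r ^ -b] for all small [r], and
[b <= (1 - theta) * c], then already the whole of [F], hence each
[B(x, rho) `&` F], is covered by [(rho / r) ^ c] balls; scales [r] that are not
small are absorbed in the constant. So the Assouad spectrum at [theta] is at
most [c] ([assouad_spectrum_le]). For any [c] greater than the box dimension
this applies as soon as [theta] is small.

Lower bound. A grid splits [F] into at most [K * rho ^ -d] pieces of Euclidean
diameter at most [rho] ([bounded_grid]). Each nonempty piece lies in some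
[B(x, rho) `&` F] with [x] in [F], hence
[N_r(F) <= K * rho ^ -d * C * (rho / r) ^ s] for every exponent [s] admissible
in the Assouad spectrum. Since [rho ^ -d = r ^ -(d * theta)], the box dimension
is at most [d * theta + s] ([upper_box_dim_le_assouad]); let [theta] tend
to 0. *)

(** * Upper limits along a filter *)

Lemma limf_esup_le (R : realType) (f : R -> \bar R) (G : set_system R)
    (a : \bar R) :
  (\forall x \near G, (f x <= a)%E) -> (limf_esup f G <= a)%E.
Proof.
move=> Ga; rewrite /limf_esup; apply: ge_ereal_inf.
exists (ereal_sup [set f x | x in [set x | (f x <= a)%E]]).
  by exists [set x | (f x <= a)%E].
by apply: ge_ereal_sup => _ [x + <-].
Qed.

Lemma limf_esup_ge (R : realType) (f : R -> \bar R) (G : set_system R)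
    {PG : ProperFilter G} (a : \bar R) :
  (\forall x \near G, (a <= f x)%E) -> (a <= limf_esup f G)%E.
Proof.
move=> Ga; apply/ereal_infP => _ [V GV <-].
have [x [Vx ax]] : exists x, V x /\ (a <= f x)%E by
  exact: (filter_ex (filterI GV Ga)).
by apply: (le_trans ax); apply: ereal_sup_ubound; exists x.
Qed.

Lemma limf_esup_lt {R : realType} {f : R -> \bar R} {G : set_system R}
    {PG : Filter G} {a : \bar R} :
  (limf_esup f G < a)%E -> \forall x \near G, (f x <= a)%E.
Proof.
move=> /ereal_inf_lt [_ [V GV <-]] supa.
apply: filterS GV => x Vx; apply: le_trans (ltW supa).
by apply: ereal_sup_ubound; exists x.
Qed.

Lemma near0_right {R : realType} {P : R -> Prop} :
  (\forall x \near 0^'+, P x) ->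
  exists2 e : R, 0 < e & forall x, 0 < x -> x < e -> P x.
Proof.
move=> [e /= e0 Pe]; exists e => // x x0 xe.
by apply: Pe => //=; rewrite sub0r normrN gtr0_norm.
Qed.

(** * Covering numbers of bounded sets *)

Section Covering.
Context {R : realType} {d : nat}.
Implicit Types (E : set 'rV[R]_d) (r : R).

Lemma covered_by_fin {T : finType} {c : T -> 'rV[R]_d} {r E} :
  E `<=` \bigcup_t eball (c t) r -> covered_by r E #|T|.
Proof.
move=> sub; exists (fun i => c (enum_val i)) => x /sub [t _ xt].
by exists (enum_rank t) => //; rewrite enum_rankK.
Qed.

Lemma covered_by_widen {r E m n} : (m <= n)%N ->
  covered_by r E m -> covered_by r E n.
Proof.
move=> mn [c sub].
exists (fun i : 'I_n => if insub (val i) is Some j then c j else 0) => x.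
move=> /sub [j _ xj]; exists (widen_ord mn j) => //.
by rewrite /= insubT //= => lt; rewrite (_ : Sub _ _ = j) //; apply: val_inj.
Qed.

Lemma covered_by_sub {r r' E E' n} : r' <= r -> E `<=` E' ->
  covered_by r' E' n -> covered_by r E n.
Proof.
move=> r'r EE' [c sub]; exists c => x /EE' /sub [i _ xi].
by exists i => //; apply: le_trans r'r.
Qed.

Lemma covering_numberP {r E n} : covered_by r E n ->
  covered_by r E (covering_number r E) /\ (covering_number r E <= n)%N.
Proof.
move=> cov.
have ex : exists n, `[< covered_by r E n >] by exists n; apply/asboolP.
case: (ex_minnP ex) => m /asboolP covm minm.
have : [set k | covered_by r E k /\ forall j, covered_by r E j -> (k <= j)%N]
    (covering_number r E).
  apply: (xgetPex 0%N); exists m; split=> // j ?; exact/minm/asboolP.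
by move=> [? min]; split=> //; apply: min.
Qed.

(** A cover of [E'] is required to exist: the covering number of a set without
finite cover is 0. *)
Lemma covering_number_le {r r' E E' n} : r' <= r -> E `<=` E' ->
  covered_by r' E' n -> (covering_number r E <= covering_number r' E')%N.
Proof.
move=> r'r EE' /covering_numberP[cov _].
by have /covering_numberP[] := covered_by_sub r'r EE' cov.
Qed.

(** If each fiber of [q] in [E] is covered by [m] balls, then [E] is covered by
[m] balls for each value of [q]. *)
Lemma covered_by_fibers {I : finType} (q : 'rV[R]_d -> I) {r E m} :
  (forall i, covered_by r (E `&` q @^-1` [set i]) m) ->
  covered_by r E (#|I| * m).
Proof.
move=> /choice[c sub].
have -> : (#|I| * m = #|{: I * 'I_m}|)%N by rewrite card_prod card_ord.
apply: (covered_by_fin (c := fun p : I * 'I_m => c p.1 p.2)) => x Ex.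
by have [|j _ xj] := sub (q x) x; [split|exists (q x, j)].
Qed.

(** The divisor [d.+1], rather than the optimal square root of [d], is never
zero. *)
Lemma enorm_le {x : 'rV[R]_d} {r} : 0 <= r ->
  (forall i, `|x ord0 i| <= r / d.+1%:R) -> enorm x <= r.
Proof.
move=> r0 xi; rewrite /enorm -[leRHS](ger0_norm r0) -sqrtr_sqr ler_wsqrtr //.
apply: (@le_trans _ _ (\sum_(i < d) (r / d.+1%:R) ^+ 2)).
  apply: ler_sum => i _; rewrite -real_normK ?num_real //.
  by rewrite lerXn2r // ?nnegrE ?normr_ge0 // divr_ge0.
rewrite sumr_const card_ord expr_div_n -[leLHS]mulr_natr -mulrA.
rewrite ler_piMr ?sqr_ge0 //.
rewrite mulrC ler_pdivrMr ?mul1r ?exprn_gt0 // -natrX ler_nat.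
by rewrite expnS expn1 (leq_trans (leqnSn d)) // leq_pmulr.
Qed.

Lemma norm_coord_le (x : 'rV[R]_d) i : `|x ord0 i| <= `|x|.
Proof.
rewrite {2}/Num.norm /= mx_normrE.
exact: (le_bigmax 0 (fun ij : 'I_1 * 'I_d => `|x ij.1 ij.2|) (ord0, i)).
Qed.

(** [q] maps a point of [F] to the grid cube that contains it. Two points in the same
cube are at Euclidean distance at most [r], and the number of cubes grows at
most like [r ^ -d]. *)
Lemma bounded_grid {F : set 'rV[R]_d} : bounded_set F ->
  exists2 K : R, 0 < K & forall r, 0 < r -> r < 1 ->
    exists (I : finType) (q : 'rV[R]_d -> I), #|I|%:R <= K * r^-1 ^+ d /\
      forall x y, F x -> F y -> q x = q y -> enorm (y - x) <= r.
Proof.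
move=> bF; have [M M0 FM] : exists2 M : R, 0 < M & forall x, F x -> `|x| <= M.
  have [M [_ FM]] := bF; exists (Num.max M 0 + 1) => [|x Fx].
    by rewrite ltr_wpDl // le_max lexx orbT.
  by apply: FM => //; rewrite ltr_pwDr // le_max lexx.
have d0 : 0 < d.+1%:R :> R by rewrite ltr0n.
exists ((2 * M * d.+1%:R + 1) ^+ d) => [|r r0 r1].
  by rewrite exprn_gt0 // addr_gt0 // !mulr_gt0.
(* Cubes of side [h], counted from the corner [(-M, ..., -M)]. *)
pose h := r / d.+1%:R; have h0 : 0 < h by rewrite divr_gt0.
pose m := Num.truncn (2 * M / h).
exists {ffun 'I_d -> 'I_m.+1}.
exists (fun x => [ffun i => inord (Num.truncn ((x ord0 i + M) / h))]); split.
  rewrite card_ffun !card_ord natrX -exprMn lerXn2r ?nnegrE //.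
    by rewrite mulr_ge0 ?invr_ge0 ?(ltW r0) // addr_ge0 // !mulr_ge0 // ltW.
  rewrite -natr1 mulrDl mul1r lerD //.
    apply: le_trans (_ : 2 * M / h <= _).
      by rewrite truncn_le divr_ge0 ?(ltW h0) // mulr_ge0 // ltW.
    by rewrite /h invf_div mulrA.
  by rewrite invf_ge1 // ltW.
move=> x y Fx Fy /ffunP qxy; apply: enorm_le (ltW r0) _ => i.
have := qxy i; rewrite !ffunE.
have pos z : F z -> 0 <= (z ord0 i + M) / h <= 2 * M / h.
  move=> Fz; have := le_trans (norm_coord_le z i) (FM _ Fz).
  rewrite ler_norml => /andP[? ?].
  by rewrite divr_ge0 ?(ltW h0) ?ler_pM2r ?invr_gt0 //=; lra.
have small z : F z -> (Num.truncn ((z ord0 i + M) / h) < m.+1)%N.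
  by move=> /pos/andP[? ?]; rewrite ltnS le_truncn.
move=> /(congr1 val); rewrite /= !inordK ?small // => eqt.
have /andP[x0 _] := pos _ Fx; have /andP[y0 _] := pos _ Fy.
have /andP[] := truncn_itv x0; have /andP[] := truncn_itv y0.
rewrite -/h !mxE -eqt -natr1 !(ler_pdivlMr _ _ h0).
rewrite !(ltr_pdivrMr _ _ h0) ler_norml.
move=> *.
by apply/andP; split; lra.
Qed.

Lemma bounded_covered {F : set 'rV[R]_d} {r} : bounded_set F -> 0 < r ->
  exists n, covered_by r F n.
Proof.
move=> bF r0; have [K K0 grid] := bounded_grid bF.
(* The grid is only available at scales less than 1. *)
pose r' := Num.min r 2^-1.
have r'0 : 0 < r' by rewrite lt_min r0 invr_gt0 ltr0n.
have r'1 : r' < 1 by rewrite gt_min invf_lt1 ?ltr1n ?orbT.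
have [I [q [_ qF]]] := grid _ r'0 r'1.
exists (#|I| * 1)%N; apply: (covered_by_fibers q) => i.
have [[x [Fx qx]]|no] := pselect (exists x, F x /\ q x = i); last first.
  by exists (fun=> 0) => x [Fx qx]; case: no; exists x.
exists (fun=> x) => y [Fy /= qy]; exists ord0 => //=.
apply: (le_trans (qF x y Fx Fy _)); first by rewrite qx qy.
by rewrite ge_min lexx.
Qed.

End Covering.

(** * Comparison of the dimensions *)

(** The logarithm of [rho / r] for [rho = r `^ theta]. *)
Lemma ln_powR_quot (R : realType) (r theta : R) : 0 < r ->
  ln (r `^ theta / r) = (1 - theta) * - ln r.
Proof.
move=> r0; rewrite ln_div ?posrE ?powR_gt0 // ln_powR; ring.
Qed.

Lemma powR_expR (R : realType) (x s : R) : 0 < x -> x `^ s = expR (s * ln x).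
Proof. by move=> x0; rewrite /powR gt_eqF. Qed.

Section Dimensions.
Context {R : realType} {d : nat} {F : set 'rV[R]_d}.
Context (bF : bounded_set F) (F0 : F != set0).

Lemma assouad_spectrum_le (theta b c : R) : 0 < theta -> theta < 1 ->
  0 <= c -> b <= (1 - theta) * c ->
  (\forall delta \near 0^'+,
    ln (covering_number delta F)%:R / - ln delta <= b) ->
  (assouad_spectrum theta F <= c%:E)%E.
Proof.
move=> t0 t1 c0 bc /near0_right[e e0 boxb].
rewrite /assouad_spectrum (negPf F0); apply: ereal_inf_lbound.
exists c => //; split=> //.
exists ((covering_number e F)%:R + 1); split=> [|r rho r0 rE rrho rho1 x Fx].
  by rewrite ltr_wpDl.
have rho0 : 0 < rho by exact: lt_trans rrho.
have r1 : r < 1 by exact: lt_trans rho1.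
have lnr : 0 < - ln r by rewrite oppr_gt0 ln_lt0 // r0.
have rhoE : rho = r `^ theta.
  by rewrite rE -powRrM mulVf ?gt_eqF // powRr1 // ltW.
have quot1 : 1 <= (rho / r) `^ c.
  rewrite powR_expR ?divr_gt0 // rhoE ln_powR_quot // -[leLHS]expR0 ler_expR.
  by rewrite mulr_ge0 // mulr_ge0 ?(ltW lnr) // subr_ge0 ltW.
have Nle : (covering_number r (eball x rho `&` F) <= covering_number r F)%N.
  have [n cov] := bounded_covered bF r0.
  exact: covering_number_le (lexx r) (@subIsetr _ _ _) cov.
apply: (@le_trans _ _ (covering_number r F)%:R); first by rewrite ler_nat.
(* For [r] at least [e], monotonicity bounds the count by the constant
   [covering_number e F]. *)
have [er|re] := leP e r.
  have [n cov] := bounded_covered bF e0.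
  apply: (@le_trans _ _ (covering_number e F)%:R).
    by rewrite ler_nat (covering_number_le er (@subset_refl _ F) cov).
  apply: le_trans (ler_peMr _ quot1); first by rewrite lerDl.
  by rewrite addr_ge0.
apply: (@le_trans _ _ ((rho / r) `^ c)); last first.
  by rewrite ler_peMl ?powR_ge0 // lerDr.
have [->|N0] := posnP (covering_number r F); first exact: powR_ge0.
rewrite -[leLHS]lnK ?posrE ?ltr0n // powR_expR ?divr_gt0 // ler_expR.
have := boxb r r0 re; rewrite ler_pdivrMr // => /le_trans; apply.
rewrite rhoE ln_powR_quot // mulrA ler_pM2r // mulrC; lra.
Qed.

(** [C] and [s] witness that the Assouad spectrum at [theta] is at most [s]. *)
Lemma upper_box_dim_le_assouad (theta s C : R) : 0 < theta -> theta < 1 ->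
  0 <= s -> 0 < C ->
  (forall r rho : R, 0 < r -> r = rho `^ theta^-1 -> r < rho -> rho < 1 ->
    forall x : 'rV[R]_d, F x ->
    (covering_number r (eball x rho `&` F))%:R <= C * (rho / r) `^ s) ->
  (upper_box_dim F <= (d%:R * theta + s)%:E)%E.
Proof.
move=> t0 t1 s0 C0 local.
have [K K0 grid] := bounded_grid bF.
apply/lee_addgt0Pr => eps eps0; rewrite -EFinD.
rewrite /upper_box_dim (negPf F0); apply: limf_esup_le.
(* Once [- ln r] exceeds [A], the constant [K * C] adds at most [eps] to the
   quotient. *)
pose A := `|ln (K * C)| / eps.
near=> r; rewrite lee_fin.
have r0 : 0 < r by near: r; exact: nbhs_right_gt.
have r1 : r < 1 by near: r; exact: nbhs_right_lt.
have lnr : 0 < - ln r by rewrite oppr_gt0 ln_lt0 // r0.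
have rA : A <= - ln r.
  rewrite lerNr -[leRHS]expRK ler_ln ?posrE ?expR_gt0 //.
  by near: r; apply: nbhs_right_le; exact: expR_gt0.
pose rho := r `^ theta.
have rho0 : 0 < rho by exact: powR_gt0.
have rrho : r < rho.
  rewrite /rho powR_expR // -[ltLHS]lnK ?posrE // ltr_expR.
  have : 0 < (1 - theta) * - ln r by rewrite mulr_gt0 // subr_gt0.
  lra.
have rho1 : rho < 1.
  by rewrite /rho powR_expR // expR_lt1 pmulr_rlt0 // -oppr_gt0.
have rE : r = rho `^ theta^-1.
  by rewrite -powRrM mulfV ?gt_eqF // powRr1 // ltW.
have [I [q [cardI qF]]] := grid _ rho0 rho1.
pose B := C * (rho / r) `^ s.
have B0 : 0 < B by rewrite mulr_gt0 // powR_gt0 // divr_gt0.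
pose m := Num.truncn B.
have cov : covered_by r F (#|I| * m).
  apply: (covered_by_fibers q) => i.
  have [[x [Fx qx]]|no] := pselect (exists x, F x /\ q x = i); last first.
    by exists (fun=> 0) => x [Fx qx]; case: no; exists x.
  have [n covF] := bounded_covered bF r0.
  have [covx _] := covering_numberP
    (covered_by_sub (lexx r) (@subIsetr _ (eball x rho) F) covF).
  apply: (covered_by_sub (lexx r) (E' := eball x rho `&` F)).
    by move=> y [Fy /= qy]; split=> //; apply: qF => //; rewrite qx qy.
  apply: covered_by_widen covx.
  by rewrite truncn_ge_nat ?(ltW B0) //; exact: local.
have [_ Nle] := covering_numberP cov.
rewrite ler_pdivrMr //.
have lnKC : ln (K * C) <= eps * - ln r.
  rewrite -ler_pdivrMl // mulrC; apply: le_trans rA.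
  by rewrite ler_pM2r ?invr_gt0 ?ler_norm.
have X0 : 0 <= s * (theta * - ln r) by rewrite !mulr_ge0 // ltW.
have [->|N0] := posnP (covering_number r F).
  by rewrite ln0 // mulr_ge0 ?(ltW lnr) // !addr_ge0 ?mulr_ge0 // ltW.
apply: (@le_trans _ _ (ln (K * C * (rho^-1 ^+ d * (rho / r) `^ s)))).
  have Q0 : 0 < K * C * (rho^-1 ^+ d * (rho / r) `^ s).
    by rewrite !mulr_gt0 ?exprn_gt0 ?powR_gt0 ?divr_gt0 ?invr_gt0.
  rewrite ler_ln ?posrE ?ltr0n //.
  apply: (@le_trans _ _ (#|I| * m)%:R); first by rewrite ler_nat.
  rewrite natrM (_ : _ * _ * _ = K * rho^-1 ^+ d * B); last by rewrite /B; ring.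
  by rewrite ler_pM // truncn_le ltW.
have lnrho : ln rho^-1 = theta * - ln r.
  by rewrite lnV ?posrE // ln_powR mulrN.
rewrite lnM ?posrE ?mulr_gt0 ?exprn_gt0 ?powR_gt0 ?divr_gt0 ?invr_gt0 //.
rewrite (@lnM _ (rho^-1 ^+ d)) ?posrE ?exprn_gt0 ?powR_gt0
  ?divr_gt0 ?invr_gt0 //.
rewrite lnXn ?invr_gt0 // ln_powR ln_powR_quot // lnrho -mulr_natl.
lra.
Unshelve. all: by end_near.
Qed.

Lemma upper_box_dim_ge0 : (0 <= upper_box_dim F)%E.
Proof.
rewrite /upper_box_dim (negPf F0); apply: limf_esup_ge.
near=> r; rewrite lee_fin.
have r0 : 0 < r by near: r; exact: nbhs_right_gt.
have r1 : r < 1 by near: r; exact: nbhs_right_lt.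
have lnr : 0 < - ln r by rewrite oppr_gt0 ln_lt0 // r0.
rewrite divr_ge0 ?(ltW lnr) //.
case: (covering_number r F) => [|n]; first by rewrite ln0.
by rewrite ln_ge0 // ler1n.
Unshelve. all: by end_near.
Qed.

Lemma generalized_upper_box_dim_le :
  (generalized_upper_box_dim F <= upper_box_dim F)%E.
Proof.
have := upper_box_dim_ge0.
case BE: (upper_box_dim F) => [b| |] //; last by rewrite !leey.
rewrite lee_fin => b0; apply/lee_addgt0Pr => eps eps0; rewrite -EFinD.
apply: limf_esup_le.
(* [b' <= (1 - theta) * (b + eps)] as soon as
   [theta <= eps / 2 / (b + eps)]. *)
pose b' := b + eps / 2.
have boxb : \forall delta \near 0^'+,
    ln (covering_number delta F)%:R / - ln delta <= b'.
  have : (upper_box_dim F < b'%:E)%E by rewrite BE lte_fin /b'; lra.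
  rewrite /upper_box_dim (negPf F0) => /limf_esup_lt.
  by apply: filterS => x; rewrite lee_fin.
have c0 : 0 < b + eps by lra.
near=> theta.
have t0 : 0 < theta by near: theta; exact: nbhs_right_gt.
have t1 : theta < 1 by near: theta; exact: nbhs_right_lt.
have te : theta <= eps / 2 / (b + eps).
  by near: theta; apply: nbhs_right_le; rewrite !divr_gt0.
apply: assouad_spectrum_le boxb => //; first exact: ltW.
by move: te; rewrite ler_pdivlMr // /b'; lra.
Unshelve. all: by end_near.
Qed.

Lemma upper_box_dim_le_generalized :
  (upper_box_dim F <= generalized_upper_box_dim F)%E.
Proof.
apply/lee_addgt0Pr => eps eps0.
rewrite -leeBlDr //; apply: limf_esup_ge.
near=> theta.
have t0 : 0 < theta by near: theta; exact: nbhs_right_gt.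
have t1 : theta < 1 by near: theta; exact: nbhs_right_lt.
have te : theta <= eps / d.+1%:R.
  by near: theta; apply: nbhs_right_le; rewrite divr_gt0.
rewrite /assouad_spectrum (negPf F0).
apply/ereal_infP => _ [s [s0 [C [C0 local]]] <-].
rewrite leeBlDr //.
apply: (le_trans (upper_box_dim_le_assouad theta s C _ _ _ _ local)) => //.
rewrite -EFinD lee_fin addrC lerD2l.
move: te; rewrite ler_pdivlMr // -natr1; nra.
Unshelve. all: by end_near.
Qed.

End Dimensions.

Theorem proposition3p3 (R : realType) (d : nat) (F : set 'rV[R]_d)
  (hF : bounded_set F) :
  generalized_upper_box_dim F = upper_box_dim F.
Proof.
(* Both dimensions of the empty set are 0 by convention. *)
have [->|F0] := eqVneq F set0; last first.
  apply/eqP; rewrite eq_le; apply/andP; split.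
    exact: generalized_upper_box_dim_le.
  exact: upper_box_dim_le_generalized.
rewrite /generalized_upper_box_dim /upper_box_dim /assouad_spectrum eqxx.
apply/eqP; rewrite eq_le; apply/andP; split.
  by apply: limf_esup_le; apply: nearW.
by apply: limf_esup_ge; apply: nearW.
Qed.
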